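(* Consider the finite horizon discounted expected cost transmission scheduling problem with a single receiver and linear power-rate curves, with value functions $V_n$ and functions $g_n$ as defined in the context. For every $n\in\{1,2,\ldots,N\}$ and $s\in\mathcal{S}$, define the critical number $$b_n(s):=\min\Bigl\{\hat y\in[d,\infty): g_n(\hat y,s)=\min_{y\in[d,\infty)}g_n(y,s)\Bigr\}.$$ Then the optimal buffer level after transmission with $n$ slots remaining, in state $(x,s)$, is $$y_n^*(x,s)=\begin{cases}x,&\text{if }x\ge b_n(s),\\ b_n(s),&\text{if }b_n(s)-\frac{P}{c_s}\le x<b_n(s),\\ x+\frac{P}{c_s},&\text{if }x<b_n(s)-\frac{P}{c_s},\end{cases}$$ or, equivalently, the optimal number of packets to transmit in slot $n$ is $$z_n^*(x,s)=\begin{cases}0,&\text{if }x\ge b_n(s),\\ b_n(s)-x,&\text{if }b_n(s)-\frac{P}{c_s}\le x<b_n(s),\\ \frac{P}{c_s},&\text{if }x<b_n(s)-\frac{P}{c_s}.\end{cases}$$ Furthermore, for each fixed $s\in\mathcal{S}$, $b_n(s)$ is nondecreasing in $n$: $$N\cdot d\ge b_N(s)\ge b_{N-1}(s)\ge\cdots\ge b_1(s)=d.$$ If, in addition, the channel condition is independent and identically distributed from slot to slot, then for each fixed $n$, $b_n(s)$ is nonincreasing in $c_s$; i.e., for arbitrary $s^1,s^2\in\mathcal{S}$ with $c_{s^1}\le c_{s^2}$, $$n\cdot d\ge b_n(s_{\mathrm{best}})\ge b_n(s^1)\ge b_n(s^2)\ge b_n(s_{\mathrm{worst}})=d.$$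
   Context: Time is discrete and indexed backwards: $n=N,N-1,\ldots,1$ is the number of slots remaining in a horizon of length $N\in\mathbb{N}$. The channel condition process $\{S_n\}_{n=N,N-1,\ldots,1}$ is a finite-state ergodic homogeneous Markov chain with state space $\mathcal{S}$ (given $S_n$, the later conditions $S_{n-1},S_{n-2},\ldots$ are independent of $S_{n+1},S_{n+2},\ldots$), whose evolution is unaffected by the scheduling decisions. Transmitting $r\ge0$ packets (a real number) under channel condition $s$ consumes power $c_s\cdot r$ with $c_s>0$. $P>0$ is the power available per slot and $d>0$ is the number of packets removed from the receiver buffer at the end of each slot. With $c_{\min}:=\min_{s}c_s$ and $c_{\max}:=\max_s c_s$, $s_{\mathrm{best}}$ and $s_{\mathrm{worst}}$ denote channel conditions with $c_{s_{\mathrm{best}}}=c_{\min}$ and $c_{s_{\mathrm{worst}}}=c_{\max}$; it is assumed that $0<c_{\min}\le c_{\max}\le P/d$. The holding cost function $h:[0,\infty)\to[0,\infty)$ is convex and nondecreasing, with $h(0)=0$ and $\lim_{x\to\infty}h(x)=\infty$. The discount factor is $\alpha\in[0,1]$. At the beginning of slot $n$ the scheduler observes the buffer level $X_n=x\ge0$ and the channel condition $S_n=s$ and chooses the number of packets $Z_n=z$ to transmit, subject to $z\ge\max(0,d-x)$ (no underflow) and $c_s z\le P$ (power constraint). Then $X_{n-1}=X_n+Z_n-d$. The slot cost is $c_s z+h(x+z-d)$, and the problem is to minimize the expected discounted cost $\mathbb{E}\bigl[\sum_{t=1}^N\alpha^{N-t}\{c_{S_t}Z_t+h(X_t+Z_t-d)\}\bigr]$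 over all history-dependent randomized and deterministic policies. With $y=x+z$ (the buffer level after transmission and before playout), the dynamic programming equations are $V_0(x,s)=0$ and, for $n=1,\ldots,N$, $x\ge 0$, $s\in\mathcal{S}$, $$V_n(x,s)=-c_s x+\min_{\max(x,d)\le y\le x+P/c_s}g_n(y,s),$$ $$g_n(y,s):=c_s y+h(y-d)+\alpha\,\mathbb{E}\bigl[V_{n-1}(y-d,S_{n-1})\mid S_n=s\bigr],\quad y\in[d,\infty).$$ ''Optimal'' buffer level (transmission quantity) in state $(x,s)$ with $n$ slots remaining means one attaining the minimum in this equation (with $z=y-x$). *)

(* Defs.v *)
From HB Require Import structures.
From mathcomp Require Import all_boot all_order all_algebra.
From mathcomp Require Import all_classical all_reals all_analysis.

Set Implicit Arguments.
Unset Strict Implicit.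
Unset Printing Implicit Defensive.

Import Order.TTheory GRing.Theory Num.Theory.
Import numFieldNormedType.Exports.

Local Open Scope classical_set_scope.
Local Open Scope ring_scope.

Section MarkovChain.
Variables (R : realType) (S : finType).
Implicit Type p : S -> S -> R.

Definition stochastic p : Prop :=
  (forall s t, 0 <= p s t) /\ (forall s, \sum_t p s t = 1).

Fixpoint pstep p (k : nat) (s t : S) : R :=
  if k is k'.+1 then \sum_u p s u * pstep p k' u t else (s == t)%:R.

Definition irreducible p : Prop :=
  forall s t, exists k, 0 < pstep p k s t.

(* For every state, the gcd of its possible return times is 1. *)
Definition aperiodic p : Prop :=
  forall s (m : nat),
    (forall k, (0 < k)%N -> 0 < pstep p k s s -> (m %| k)%N) -> m = 1%N.

Definition ergodic p : Prop := irreducible p /\ aperiodic p.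

(* A homogeneous chain with kernel [p] is an i.i.d. sequence when the
   conditional law of the next state does not depend on the current one. *)
Definition iid p : Prop :=
  exists q : S -> R, forall s t, p s t = q t.

End MarkovChain.

Definition is_minimizer (R : realType) (T : Type) (A : set T) (f : T -> R)
  (x : T) : Prop := A x /\ forall y, A y -> f x <= f y.

(* [trans s t] is the probability that the channel moves from [s], with n
   slots remaining, to [t], with n - 1 slots remaining.  Only the values of
   [hold] on [0, +oo[ are ever used. *)
Record scheduling (R : realType) (S : finType) := Scheduling {
  trans : S -> S -> R;
  cost : S -> R;
  power : R;
  drain : R;
  hold : R -> R;
  disc : R }.

Section DynamicProgram.
Variables (R : realType) (S : finType) (M : scheduling R S).
Local Notation c := (cost M).
Local Notation P := (power M).
Local Notation d := (drain M).

Definition post_cost (W : R -> S -> R) (y : R) (s : S) : R :=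
  c s * y + hold M (y - d) + disc M * \sum_t trans M s t * W (y - d) t.

Definition levels (x : R) (s : S) : set R :=
  `[Num.max x d, x + P / c s]%classic.

(* The minimum is written [inf]; that it is attained is part of the theorem
   (see [optimal_level]). *)
Fixpoint V (n : nat) (x : R) (s : S) : R :=
  if n is m.+1 then
    - c s * x + inf [set post_cost (V m) y s | y in levels x s]
  else 0.

(* Meaningful for n >= 1 only. *)
Definition g (n : nat) (y : R) (s : S) : R := post_cost (V n.-1) y s.

Definition optimal_level (n : nat) (x : R) (s : S) (y : R) : Prop :=
  is_minimizer (levels x s) (g n ^~ s) y.

Definition optimal_quantity (n : nat) (x : R) (s : S) (z : R) : Prop :=
  optimal_level n x s (x + z).

Definition g_minimizers (n : nat) (s : S) : set R :=
  [set y | is_minimizer `[d, +oo[%classic (g n ^~ s) y].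

(* Again [inf] stands for a minimum, whose existence the theorem asserts. *)
Definition b (n : nat) (s : S) : R := inf (g_minimizers n s).

Definition ystar (n : nat) (x : R) (s : S) : R :=
  if b n s <= x then x
  else if b n s - P / c s <= x then b n s
  else x + P / c s.

Definition zstar (n : nat) (x : R) (s : S) : R :=
  if b n s <= x then 0
  else if b n s - P / c s <= x then b n s - x
  else P / c s.

End DynamicProgram.

(* Main.v *)
(** By induction each [g_n(., s)] is convex and continuous on [d, +oo[ and
    nondecreasing on [n d, +oo[, so it has a least minimizer [b_n(s) <= n d], and
    convexity makes the clipped level [min (max x b_n(s)) (x + P / c_s)] optimal;
    this formula in turn makes [V_n] continuous.

    [V_n - V_{n-1}] is nonincreasing on [0, n d] (Topkis: minimizing a submodular
    function over a sublattice keeps it submodular), hence so is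
    [g_{n+1} - g_n] on [d, (n+1) d], which moves the minimizer to the right.
    The range restriction is essential: past [n d] the difference can increase.
    In the i.i.d. case [g_n(y, s)] depends on [s] only through [c_s y].  Finally
    [V_n(x, s) + c_max x] is nondecreasing in [x], so [g_n(., s_worst)] is
    nondecreasing and [b_n(s_worst) = d]. *)

Require Import Defs.
From HB Require Import structures.
From mathcomp Require Import all_boot all_order all_algebra.
From mathcomp Require Import all_classical all_reals all_analysis.
From mathcomp Require Import ring lra.

Set Implicit Arguments.
Unset Strict Implicit.
Unset Printing Implicit Defensive.

Import Order.TTheory GRing.Theory Num.Theory.
Import numFieldNormedType.Exports.

Local Open Scope classical_set_scope.
Local Open Scope ring_scope.

(** * Convex functions on a closed half-line: continuity and minimizers *)

Section HalfLine.
Variable R : realType.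
Implicit Types (a b c x y : R) (f h : R -> R).

Definition convex_from a f : Prop := forall t x y, 0 <= t <= 1 ->
  a <= x -> a <= y -> f (t * x + (1 - t) * y) <= t * f x + (1 - t) * f y.

(** Clamping the argument at [a] turns continuity on [[a, +oo[] into continuity on the whole line,
    so that the usual composition rules apply without subspace topologies. *)
Definition continuous_from a f : Prop := continuous (fun x => f (Num.max a x)).

Definition nondecreasing_from a f : Prop :=
  forall x y, a <= x -> x <= y -> f x <= f y.

(** The weight of [u] in [w] is [(v - w) / (v - u)]. Clearing this denominator leaves a form suited
    to linear arithmetic. *)
Lemma convex_from_chord a f u w v : convex_from a f ->
  a <= u -> u <= w -> w <= v -> u < v ->
  (v - u) * f w <= (v - w) * f u + (w - u) * f v.
Proof.
move=> cf au uw wv uv; have vu0 : 0 < v - u by rewrite subr_gt0.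
have vuN0 : v - u != 0 by rewrite gt_eqF.
have t01 : 0 <= (v - w) / (v - u) <= 1.
  by rewrite divr_ge0 ?subr_ge0 ?(ltW uv)//= ler_pdivrMr// mul1r lerD2l lerN2.
have := cf _ _ _ t01 au (le_trans au (ltW uv)).
have -> : (v - w) / (v - u) * u + (1 - (v - w) / (v - u)) * v = w by field.
rewrite -(ler_pM2l vu0) => /le_trans; apply; rewrite le_eqVlt.
by apply/orP; left; apply/eqP; field.
Qed.

Lemma convex_from_le_max a f u w v : convex_from a f ->
  a <= u -> u <= w -> w <= v -> f w <= Num.max (f u) (f v).
Proof.
move=> cf au uw wv; have := le_trans uw wv; rewrite le_eqVlt => /predU1P[uv|uv].
  have -> : w = u by apply/eqP; rewrite eq_le uw andbT uv.
  by rewrite le_max lexx.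
rewrite -(@ler_pM2l _ (v - u)) ?subr_gt0//.
apply: (le_trans (convex_from_chord cf au uw wv uv)).
have -> : v - u = (v - w) + (w - u) by ring.
by rewrite [leRHS]mulrDl lerD// ler_wpM2l ?subr_ge0// le_max lexx ?orbT.
Qed.

(** Convexity caps the slopes on [[a, B]] by the slope [K] over [[B, B + 1]], and monotonicity makes
    them nonnegative, so [f] is Lipschitz there. Monotonicity also excludes the jump that convexity
    alone allows at [a]. *)
Lemma convex_from_continuous a f :
  convex_from a f -> nondecreasing_from a f -> continuous_from a f.
Proof.
(* The margin 1 keeps the clamp of every [z] within distance 1 of [x] below [B]. *)
move=> cf nf x; set B := Num.max a x + 1; set K := f (B + 1) - f B.
have aB : a <= B by rewrite /B ler_wpDr// le_max lexx.
have K0 : 0 <= K by rewrite subr_ge0 nf// lerDl.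
have lip u v : a <= u -> u <= v -> v <= B -> f v - f u <= K * (v - u).
  move=> au uv vB; have uB1 : u < B + 1.
    by rewrite (le_lt_trans (le_trans uv vB))// ltrDl.
  have BB1 : B <= B + 1 by rewrite lerDl.
  (* [P1] compares the slope over [[u, v]] with that over [[u, B + 1]], and [P2] compares the latter
     with [K]. *)
  have P1 := convex_from_chord cf au uv (le_trans vB BB1) uB1.
  have P2 := convex_from_chord cf au (le_trans uv vB) BB1 uB1.
  rewrite -(@ler_pM2l _ (B + 1 - u)) ?subr_gt0//.
  have {}P2 : f (B + 1) - f u <= (B + 1 - u) * K by rewrite /K; nra.
  have P3 : (v - u) * (f (B + 1) - f u) <= (v - u) * ((B + 1 - u) * K).
    by rewrite ler_wpM2l// subr_ge0.
  nra.
have lip2 u v : a <= u -> u <= B -> a <= v -> v <= B ->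
    `|f u - f v| <= K * `|u - v|.
  move=> au uB av vB; have [uv|/ltW vu] := leP u v.
    by rewrite distrC ger0_norm ?subr_ge0 ?nf// distrC ger0_norm ?subr_ge0// lip.
  by rewrite ger0_norm ?subr_ge0 ?nf// ger0_norm ?subr_ge0// lip.
apply/cvgrPdist_lt => e e0.
have K1 : 0 < K + 1 by rewrite ltr_wpDl.
near=> z.
have zx1 : `|x - z| < 1 by near: z; exact: (@cvgr_dist_lt _ _ _ _ _ (@id R) x).
have zxe : `|x - z| < e / (K + 1).
  by near: z; apply: (@cvgr_dist_lt _ _ _ _ _ (@id R) x) => //; rewrite divr_gt0.
have maxd : `|Num.max a x - Num.max a z| <= `|x - z|.
  rewrite !maxEle; case: (leP a x) => ax; case: (leP a z) => az; rewrite //.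
  - rewrite ger0_norm ?subr_ge0// ger0_norm ?subr_ge0 ?lerD2l ?lerN2 ltW//.
    exact: lt_le_trans az ax.
  - rewrite ler0_norm ?subr_le0// ler0_norm ?subr_le0; last first.
      exact: ltW (lt_le_trans ax az).
    by rewrite !opprB lerD2l lerN2 ltW.
  - by rewrite subrr normr0.
have zB : Num.max a z <= B.
  rewrite /B -lerBlDl; apply: le_trans (ltW zx1); apply: le_trans maxd.
  by rewrite distrC ler_norm.
have am w : a <= Num.max a w by rewrite le_max lexx.
apply: (le_lt_trans (lip2 _ _ (am x) _ (am z) zB)); first by rewrite lerDl.
apply: (@le_lt_trans _ _ ((K + 1) * `|x - z|)).
  by apply: ler_pM => //; rewrite lerDl.
by rewrite mulrC -ltr_pdivlMr.
Unshelve. all: by end_near. Qed.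

Lemma convex_function_from0 h :
  @convex_function R R^o `[0, +oo[%classic (h : R^o -> R^o) -> convex_from 0 h.
Proof.
move=> ch t x y /andP[t0 t1] x0 y0.
have := ch (Itv01 t0 t1) x y; apply; by rewrite inE/= in_itv/= andbT.
Qed.

Definition minimizers_from a f : set R :=
  [set y | is_minimizer `[a, +oo[%classic f y].

Lemma minimizers_fromP a f y :
  minimizers_from a f y <-> a <= y /\ forall z, a <= z -> f y <= f z.
Proof.
rewrite /minimizers_from /is_minimizer /= in_itv/= andbT; split=> -[ay fy].
  by split=> // z az; apply: fy; rewrite /= in_itv/= andbT.
by split=> // z; rewrite /= in_itv/= andbT; exact: fy.
Qed.

(** * Existence of a least minimizer *)

Section LeastMinimizer.
Variables (a D : R) (f : R -> R).
Hypotheses (aD : a <= D) (f_cont : continuous_from a f).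
Hypothesis f_ndecr : nondecreasing_from D f.

Local Notation argmin := (minimizers_from a f).

(** The extreme value theorem gives a minimizer on [[a, D]]; beyond [D] the function stays above
    [f D]. *)
Lemma minimizers_from_ex : exists2 y, argmin y & y <= D.
Proof.
have cF : {within `[a, D], continuous (fun x => f (Num.max a x))}.
  exact: continuous_subspaceT f_cont.
have [y] := EVT_min aD cF; rewrite in_itv/= => /andP[ay yD] ymin.
exists y => //; apply/minimizers_fromP; split=> // z az.
have fyz w : a <= w -> w <= D -> f y <= f w.
  by move=> aw wD; have := ymin w; rewrite in_itv/= aw wD !max_r//; exact.
have [zD|Dz] := leP z D; first exact: fyz.
by apply: (le_trans (fyz D aD (lexx D))); exact: f_ndecr (lexx D) (ltW Dz).
Qed.

Lemma inf_minimizers_le y : argmin y -> inf argmin <= y.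
Proof.
by apply: ge_inf; exists a => z /minimizers_fromP[].
Qed.

Lemma inf_minimizers_mem : argmin (inf argmin).
Proof.
have [y my yD] := minimizers_from_ex.
(* The minimizers form a sublevel set of the clamped function, cut by a closed half-line. This set
   is closed, so it contains its infimum. *)
have argminE : argmin = [set z | a <= z] `&`
    (fun x => f (Num.max a x)) @^-1` [set z | z <= f y].
  apply/seteqP; split=> z; rewrite /preimage/=.
    move=> /minimizers_fromP[az fz]; split=> //; rewrite max_r//.
    by apply: fz; case/minimizers_fromP: my.
  move=> [az]; rewrite max_r// => fzy; apply/minimizers_fromP; split=> // w aw.
  by apply: (le_trans fzy); case/minimizers_fromP: my => _; apply.
apply: itv_closed_infimums; first by exists y.
  rewrite argminE; apply: closedI; first exact: closed_ge.
  by apply: preimage_closed (@closed_le _ _) => ? _; exact: f_cont.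
split; first exact: inf_minimizers_le.
by move=> z zl; apply: lb_le_inf zl; exists y.
Qed.

Lemma inf_minimizers_bound : inf argmin <= D.
Proof. by have [y /inf_minimizers_le/le_trans] := minimizers_from_ex; exact. Qed.

End LeastMinimizer.

(** Between [y0] and [y] the values are at most the larger end value, which is [f y] since [f y0] is
    minimal. The next lemma is the mirror image. *)
Lemma convex_from_nondecreasing a f y0 : convex_from a f ->
  minimizers_from a f y0 -> nondecreasing_from y0 f.
Proof.
move=> cf /minimizers_fromP[ay0 my0] x y y0x xy.
apply: (le_trans (convex_from_le_max cf ay0 y0x xy)).
by rewrite ge_max lexx andbT my0// (le_trans ay0)// (le_trans y0x).
Qed.

Lemma convex_from_nonincreasing a f y0 x y : convex_from a f ->
  minimizers_from a f y0 -> a <= x -> x <= y -> y <= y0 -> f y <= f x.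
Proof.
move=> cf /minimizers_fromP[ay0 my0] ax xy yy0.
apply: (le_trans (convex_from_le_max cf ax xy yy0)).
by rewrite ge_max lexx my0.
Qed.

(** If [B < b], then [F B <= F b] and the difference bound give [f B <= f b], so [B] would minimize
    [f] to the left of its least minimizer. The bound is only needed up to [b], so range-restricted
    estimates suffice. *)
Lemma minimizers_from_mono a f F b B :
  minimizers_from a f b -> (forall y, minimizers_from a f y -> b <= y) ->
  minimizers_from a F B ->
  (forall x y, a <= x -> x <= y -> y <= b -> F y - F x <= f y - f x) ->
  b <= B.
Proof.
move=> /minimizers_fromP[ab mb] bl /minimizers_fromP[aB mB] dd.
rewrite leNgt; apply/negP => Bb; have := dd _ _ aB (ltW Bb) (lexx b).
have := mB _ ab => FBb fd; suff /bl : minimizers_from a f B by rewrite leNgt Bb.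
apply/minimizers_fromP; split=> // z az; apply: le_trans (mb z az).
lra.
Qed.

End HalfLine.

(** * The Bellman recursion and the regularity it propagates *)

Section Scheduling.
Variables (R : realType) (S : finType) (M : scheduling R S) (sworst : S).
Local Notation c := (cost M).
Local Notation P := (power M).
Local Notation d := (drain M).
Local Notation h := (hold M).
Local Notation al := (disc M).
Local Notation p := (trans M).

Hypothesis p_ge0 : forall s t, 0 <= p s t.
Hypothesis p_sum : forall s, \sum_t p s t = 1.
Hypothesis d_gt0 : 0 < d.
Hypothesis c_gt0 : forall s, 0 < c s.
Hypothesis c_le_worst : forall s, c s <= c sworst.
Hypothesis d_le : forall s, d <= P / c s.
Hypothesis h_convex : convex_from 0 h.
Hypothesis h_ndecr : nondecreasing_from 0 h.
Hypothesis al_ge0 : 0 <= al.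
Hypothesis al_le1 : al <= 1.

Lemma levelsP x s y :
  levels M x s y <-> [/\ x <= y, d <= y & y <= x + P / c s].
Proof.
rewrite /levels/= in_itv/= ge_max; split; first by move=> /andP[/andP[]].
by case=> -> -> ->.
Qed.

Let level_max x s : 0 <= x -> levels M x s (x + P / c s).
Proof.
move=> x0; have := d_le s; move: d_gt0 => d0 dP; apply/levelsP.
by split=> //; lra.
Qed.

Lemma V_optimal n x s y : optimal_level M n.+1 x s y ->
  V M n.+1 x s = - c s * x + g M n.+1 y s.
Proof.
move=> [ly ymin] /=; congr (_ + _); apply/eqP; rewrite eq_le; apply/andP; split.
  apply: ge_inf; last by exists y.
  by exists (g M n.+1 y s) => _ [z lz <-]; exact: ymin.
apply: lb_le_inf; first by exists (g M n.+1 y s), y.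
by move=> _ [z lz <-]; exact: ymin.
Qed.

Lemma V_le n x s y z : optimal_level M n.+1 x s y -> levels M x s z ->
  V M n.+1 x s <= - c s * x + g M n.+1 z s.
Proof. by move=> oy lz; rewrite (V_optimal oy) lerD2l; case: oy => _; exact. Qed.

(** The induction invariant. A buffer of [n * d] covers the whole remaining horizon, whence the
    threshold. Continuity is carried along because [V M n] may decrease near 0, where
    [convex_from_continuous] would not apply. *)
Definition value_regular n : Prop := forall s,
  [/\ convex_from 0 (V M n ^~ s), continuous_from 0 (V M n ^~ s) &
      nondecreasing_from (n%:R * d) (V M n ^~ s)].

Lemma g_regular n s : value_regular n ->
  [/\ convex_from d (g M n.+1 ^~ s), continuous_from d (g M n.+1 ^~ s) &
      nondecreasing_from (n.+1%:R * d) (g M n.+1 ^~ s)].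
Proof.
move=> Vreg; split.
- move=> t x y t01 dx dy; have /andP[t0 t1] := t01.
  have xd : 0 <= x - d by rewrite subr_ge0.
  have yd : 0 <= y - d by rewrite subr_ge0.
  have E : t * x + (1 - t) * y - d = t * (x - d) + (1 - t) * (y - d) by ring.
  have H := h_convex t01 xd yd.
  have HV : \sum_u p s u * V M n (t * x + (1 - t) * y - d) u <=
      t * (\sum_u p s u * V M n (x - d) u) +
      (1 - t) * (\sum_u p s u * V M n (y - d) u).
    rewrite !mulr_sumr -big_split/=; apply: ler_sum => u _; rewrite E.
    have [cV _ _] := Vreg u.
    apply: (le_trans (ler_wpM2l (p_ge0 s u) (cV _ _ _ t01 xd yd))).
    by rewrite le_eqVlt; apply/orP; left; apply/eqP; ring.
  have {}HV := ler_wpM2l al_ge0 HV.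
  rewrite -E in H; rewrite /g /post_cost /=.
  lra.
(* The shift by [d] carries the clamp at [d] to the clamp at 0. *)
- have shift_cont (f : R -> R) : continuous_from 0 f ->
      continuous (fun x => f (Num.max d x - d)).
    move=> cf; have -> : (fun x => f (Num.max d x - d)) =
        (fun x => f (Num.max 0 x)) \o (fun x => x - d).
      apply/funext => x /=; congr f.
      by case: (leP d x) => dx; case: (leP 0 (x - d)) => // dx0; lra.
    move=> x; apply: continuous_comp; last exact: cf.
    by apply: cvgB; [exact: cvg_id|exact: cvg_cst].
  rewrite /g /post_cost /= => x.
  apply: cvgD; first apply: cvgD.
  + apply: cvgM; first exact: cvg_cst.
    by apply: (@continuous_max R R (fun=> d) id); [exact: cvg_cst|exact: cvg_id].
  + exact: shift_cont (convex_from_continuous h_convex h_ndecr) x.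
  + apply: cvgM; first exact: cvg_cst.
    apply: cvg_big => [|u _]; first exact: add_continuous.
    apply: cvgM; first exact: cvg_cst.
    by have [_ cV _] := Vreg u; exact: shift_cont cV x.
- move=> x y nx xy; rewrite /g /post_cost /=.
  have nxd : n%:R * d <= x - d by rewrite -natr1 in nx; lra.
  have n0 : 0 <= n%:R * d by rewrite mulr_ge0// ltW.
  have xyd : x - d <= y - d by rewrite lerD2r.
  apply: lerD; first apply: lerD.
  + by rewrite ler_wpM2l// ltW.
  + by apply: h_ndecr => //; exact: le_trans nxd.
  + rewrite ler_wpM2l//; apply: ler_sum => u _; rewrite ler_wpM2l//.
    by have [_ _ nV] := Vreg u; exact: nV.
Qed.

Let d_le_nd n : d <= n.+1%:R * d.
Proof. by rewrite ler_peMl ?ler1n// ltW. Qed.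

(** * The critical number and the clipped optimal level *)

Section OneSlot.
Variables (n : nat) (s : S).
Hypothesis Vreg : value_regular n.

Lemma b_minimizer : g_minimizers M n.+1 s (b M n.+1 s).
Proof.
have [_ gcont gndecr] := g_regular s Vreg.
exact: inf_minimizers_mem (d_le_nd n) gcont gndecr.
Qed.

Lemma b_least y : g_minimizers M n.+1 s y -> b M n.+1 s <= y.
Proof. exact: inf_minimizers_le. Qed.

Lemma b_le_nd : b M n.+1 s <= n.+1%:R * d.
Proof.
have [_ gcont gndecr] := g_regular s Vreg.
exact: inf_minimizers_bound (d_le_nd n) gcont gndecr.
Qed.

Lemma d_le_b : d <= b M n.+1 s.
Proof. by have /minimizers_fromP[] := b_minimizer. Qed.

(** This form exhibits [ystar] as continuous in [x], which the case definition hides. *)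
Lemma ystarE x :
  ystar M n.+1 x s = Num.min (Num.max x (b M n.+1 s)) (x + P / c s).
Proof.
have Pc : 0 < P / c s := lt_le_trans d_gt0 (d_le s).
rewrite /ystar; case: (leP (b M n.+1 s) x) => bx.
  by rewrite min_l// lerDl ltW.
by rewrite lerBlDr; case: leP.
Qed.

(** [g] falls up to [b] and rises after it. So the best feasible level is the lowest one if
    [b <= x], [b] itself if it is reachable, and the highest one otherwise. *)
Lemma ystar_optimal x : 0 <= x -> optimal_level M n.+1 x s (ystar M n.+1 x s).
Proof.
move=> x0; have [gconv _ _] := g_regular s Vreg.
have Pc : 0 < P / c s := lt_le_trans d_gt0 (d_le s).
have db := d_le_b; have bmin := b_minimizer.
rewrite /ystar; have [bx|xb] := leP (b M n.+1 s) x.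
  split; first by apply/levelsP; split=> //; [exact: le_trans bx|rewrite lerDl ltW].
  by move=> y /levelsP[xy _ _]; exact: convex_from_nondecreasing gconv bmin _ _ bx xy.
have [bP|bP] := leP (b M n.+1 s - P / c s) x.
  split; first by apply/levelsP; split=> //; [exact: ltW|rewrite -lerBlDr].
  move=> y /levelsP[_ dy _]; case/minimizers_fromP: bmin => _; exact.
split; first exact: level_max.
move=> y /levelsP[_ dy yx].
by apply: (convex_from_nonincreasing gconv bmin) => //; rewrite -lerBrDr ltW.
Qed.

Lemma V_ystar x : 0 <= x ->
  V M n.+1 x s = - c s * x + g M n.+1 (ystar M n.+1 x s) s.
Proof. by move=> x0; exact: V_optimal (ystar_optimal x0). Qed.

End OneSlot.

Lemma value_regularS n : value_regular n -> value_regular n.+1.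
Proof.
move=> Vreg s; have [gconv gcont gndecr] := g_regular s Vreg; split.
- move=> t x y t01 x0 y0; have /andP[t0 t1] := t01.
  have z0 : 0 <= t * x + (1 - t) * y.
    by rewrite addr_ge0// mulr_ge0// subr_ge0.
  have ox := ystar_optimal s Vreg x0; have oy := ystar_optimal s Vreg y0.
  rewrite (V_optimal ox) (V_optimal oy).
  move: ox oy => [/levelsP[x1 x2 x3] _] [/levelsP[y1 y2 y3] _].
  set u := ystar M _ x s in x1 x2 x3 *; set v := ystar M _ y s in y1 y2 y3 *.
  (* The feasible pairs of state and level form a convex set, so mixing the two optimal levels gives
     a competitor for the mixed state. *)
  have lz : levels M (t * x + (1 - t) * y) s (t * u + (1 - t) * v).
    apply/levelsP; set q := P / c s in x3 y3 *; clearbody q.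
    have t1' : 0 <= 1 - t by rewrite subr_ge0.
    have := (ler_wpM2l t0 x1, ler_wpM2l t0 x2, ler_wpM2l t0 x3).
    have := (ler_wpM2l t1' y1, ler_wpM2l t1' y2, ler_wpM2l t1' y3).
    by move=> [[? ?] ?] [[? ?] ?]; split; lra.
  have := V_le (ystar_optimal s Vreg z0) lz; move/le_trans; apply.
  have := gconv _ _ _ t01 x2 y2; lra.
(* The extra [Num.max d] leaves optimal levels unchanged, and matches the clamp in the continuity of
   [g]. *)
- rewrite /continuous_from [X in continuous X](_ : _ = (fun x : R =>
      - c s * Num.max 0 x +
      g M n.+1 (Num.max d (Num.min (Num.max (Num.max 0 x) (b M n.+1 s))
        (Num.max 0 x + P / c s))) s)); last first.
    apply/funext => x; rewrite -ystarE.
    have m0 : 0 <= Num.max 0 x by rewrite le_max lexx.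
    rewrite V_ystar//; have [/levelsP[_ dy _] _] := ystar_optimal s Vreg m0.
    by rewrite (max_r dy).
  have cmax x : {for x, continuous (fun x : R => Num.max 0 x)}.
    by apply: (@continuous_max R R (fun=> 0) id); [exact: cvg_cst|exact: cvg_id].
  move=> x; apply: cvgD; first by apply: cvgM; [exact: cvg_cst|exact: cmax].
  apply: (@continuous_comp R R R (fun x => Num.min (Num.max (Num.max 0 x)
    (b M n.+1 s)) (Num.max 0 x + P / c s)) (fun y => g M n.+1 (Num.max d y) s));
    last exact: gcont.
  apply: (@continuous_min R R
    (fun x => Num.max (Num.max 0 x) (b M n.+1 s)) (fun x => Num.max 0 x + P / c s)).
    apply: (@continuous_max R R (fun x => Num.max 0 x) (fun=> b M n.+1 s)).
      exact: cmax.
    exact: cvg_cst.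
  by apply: cvgD; [exact: cmax|exact: cvg_cst].
- move=> x y nx xy.
  (* Past [n.+1%:R * d] nothing is transmitted, so the linear costs cancel and only holding cost and
     continuation remain. *)
  have bx := le_trans (b_le_nd s Vreg) nx; have bY := le_trans bx xy.
  have n0 : 0 <= n%:R * d by rewrite mulr_ge0// ltW.
  have nxd : n%:R * d <= x - d by rewrite -natr1 in nx; lra.
  have x0 : 0 <= x by move: d_gt0 => ?; lra.
  rewrite !V_ystar ?(le_trans x0)// /ystar bx bY /g /post_cost /= !mulNr !addrA.
  rewrite !addNr !add0r; apply: lerD.
    by apply: h_ndecr; [exact: le_trans nxd|rewrite lerD2r].
  rewrite ler_wpM2l//; apply: ler_sum => u _; rewrite ler_wpM2l//.
  by have [_ _ nV] := Vreg u; apply: nV; rewrite ?lerD2r.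
Qed.

Lemma value_regularP n : value_regular n.
Proof.
elim: n => [|n]; last exact: value_regularS.
by move=> s; split=> [t x y _ _ _|x|x y _ _] //=; [rewrite !mulr0 addr0|exact: cvg_cst].
Qed.
Hint Resolve value_regularP : core.

(** * Monotonicity of [b] in the number of remaining slots *)

Lemma b1 s : b M 1 s = d.
Proof.
apply/eqP; rewrite eq_le d_le_b// andbT.
by have := b_le_nd s (value_regularP 0); rewrite mul1r.
Qed.

(** The immediate costs are the same at both horizons and cancel; averaging and discounting preserve
    the inequality. Playout turns the range bound [D] into [D + d]. *)
Lemma g_decreasing_differences n s D :
  (forall t x y, 0 <= x -> x <= y -> y <= D ->
    V M n.+1 y t - V M n.+1 x t <= V M n y t - V M n x t) ->
  forall x y, d <= x -> x <= y -> y <= D + d ->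
    g M n.+2 y s - g M n.+2 x s <= g M n.+1 y s - g M n.+1 x s.
Proof.
move=> dV x y dx xy yD; rewrite /g /post_cost [n.+2.-1]/= [n.+1.-1]/=.
rewrite -subr_ge0.
set A := \sum_t _ * V M n.+1 (y - d) t; set B := \sum_t _ * V M n.+1 (x - d) t.
set A' := \sum_t _ * V M n (y - d) t; set B' := \sum_t _ * V M n (x - d) t.
have AB : A - B <= A' - B'.
  rewrite -!sumrB; apply: ler_sum => t _; rewrite -!mulrBr ler_wpM2l//.
  by apply: dV; rewrite ?subr_ge0 ?lerD2r ?lerBlDr.
have := ler_wpM2l al_ge0 AB; lra.
Qed.

(* The join and the meet of the two optimal actions are the competitors. *)
Lemma V_decreasing_differences n s x y :
  0 <= x -> x <= y -> y <= n.+1%:R * d ->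
  V M n.+1 y s - V M n.+1 x s <= V M n y s - V M n x s.
Proof.
elim: n s x y => [|n IH] s x y x0 xy yD; have y0 := le_trans x0 xy.
  (* With one slot left and [z <= d], filling up to exactly [d] is optimal, so [V M 1] is affine
     with slope [- c s]. *)
  rewrite [V M 0 y s]/= [V M 0 x s]/= subrr subr_le0.
  have E z : 0 <= z -> z <= d -> V M 1 z s = - c s * z + g M 1 d s.
    move=> z0 zd; rewrite V_ystar//; congr (_ + g M 1 _ s).
    have ez := d_le s; rewrite /ystar b1; have [dz|dz] := leP d z.
      by apply/eqP; rewrite eq_le zd dz.
    by case: leP => // w; lra.
  rewrite mul1r in yD; rewrite !E// ?(le_trans xy)// lerD2r !mulNr lerN2.
  by rewrite ler_wpM2l// ltW.
have dg u v : d <= u -> u <= v -> v <= n.+2%:R * d ->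
    g M n.+2 v s - g M n.+2 u s <= g M n.+1 v s - g M n.+1 u s.
  move=> du uv vD; apply: (@g_decreasing_differences n s (n.+1%:R * d)) => //.
  by move: vD; rewrite -[n.+2%:R]natr1 mulrDl mul1r.
have ox := ystar_optimal s (value_regularP n.+1) x0.
have oy := ystar_optimal s (value_regularP n) y0.
have ox' := ystar_optimal s (value_regularP n) x0.
have oy' := ystar_optimal s (value_regularP n.+1) y0.
have [/levelsP[Y1 Y2 Y3] _] := ox; have [/levelsP[z1 z2 z3] _] := oy.
have zD : ystar M n.+1 y s <= n.+2%:R * d.
  rewrite ystarE ge_min ge_max yD; apply/orP; left.
  rewrite (le_trans (b_le_nd s (value_regularP n)))// ler_wpM2r ?ler_nat//.
  exact: ltW.
rewrite (V_optimal ox) (V_optimal oy).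
set Y := ystar M n.+2 x s in Y1 Y2 Y3 *; set z := ystar M n.+1 y s in z1 z2 z3 zD *.
(* If [z <= Y], both levels are feasible from both states: each horizon keeps its level while the
   states are exchanged, and the [g] terms cancel exactly. Otherwise each state keeps its level, the
   horizons are exchanged, and [dg] compares the [g] terms. *)
have [zY|Yz] := leP z Y.
  have := V_le oy' (z := Y); have := V_le ox' (z := z).
  have lz : levels M x s z.
    by apply/levelsP; split=> //; [exact: le_trans xy z1|exact: le_trans zY Y3].
  have lY : levels M y s Y.
    apply/levelsP; split=> //; first exact: le_trans zY.
    by rewrite (le_trans Y3)// lerD2r.
  move=> /(_ lz) + /(_ lY); lra.
have lz : levels M y s z by apply/levelsP.
have lY : levels M x s Y by apply/levelsP.
have := V_le oy' lz; have := V_le ox' lY; have := dg _ _ Y2 (ltW Yz) zD; lra.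
Qed.

(** Differences need comparing only up to [b M n.+1 s <= n.+1%:R * d], within the range where they
    are controlled. *)
Lemma b_nondecreasing n s : b M n.+1 s <= b M n.+2 s.
Proof.
apply: (minimizers_from_mono (b_minimizer s (value_regularP n)) _
  (b_minimizer s (value_regularP n.+1))) => [y|x y dx xy yb].
  exact: b_least.
apply: (@g_decreasing_differences n s (n.+1%:R * d)) => // [t u v u0 uv vD|].
  exact: V_decreasing_differences.
rewrite (le_trans yb)// (le_trans (b_le_nd s (value_regularP n)))// lerDl.
exact: ltW.
Qed.

(** * Dependence of [b] on the channel cost *)

Lemma g_shift_worst n s x y :
  (forall t u v, 0 <= u -> u <= v ->
    V M n u t + c sworst * u <= V M n v t + c sworst * v) ->
  d <= x -> x <= y ->
  g M n.+1 x s + (c sworst - c s) * x <= g M n.+1 y s + (c sworst - c s) * y.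
Proof.
move=> dV dx xy; rewrite /g /post_cost [n.+1.-1]/=.
have xd : 0 <= x - d by rewrite subr_ge0.
have xyd : x - d <= y - d by rewrite lerD2r.
set A := \sum_t _ * V M n (x - d) t; set B := \sum_t _ * V M n (y - d) t.
(* The transition weights sum to 1, so averaging keeps the slope bound; discounting by [al <= 1]
   keeps it too. *)
have AB : A - B <= c sworst * (y - x).
  rewrite -sumrB -[leRHS]mul1r -(p_sum s) mulr_suml; apply: ler_sum => t _.
  rewrite -mulrBr ler_wpM2l//; have := dV t _ _ xd xyd; lra.
have := ler_wpM2l al_ge0 AB; have := h_ndecr xd xyd.
have : al * (c sworst * (y - x)) <= c sworst * (y - x).
  by rewrite ler_piMl// mulr_ge0 ?subr_ge0// ltW.
lra.
Qed.

(* Derivative form: [V_n' >= - c_max]. *)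
Lemma V_shift_worst n s x y : 0 <= x -> x <= y ->
  V M n x s + c sworst * x <= V M n y s + c sworst * y.
Proof.
elim: n s x y => [|n IH] s x y x0 xy; first by rewrite /= !add0r ler_wpM2l// ltW.
have y0 := le_trans x0 xy; have cs := c_le_worst s.
have ox := ystar_optimal s (value_regularP n) x0.
have oy := ystar_optimal s (value_regularP n) y0.
have [/levelsP[z1 z2 z3] _] := oy.
rewrite (V_optimal oy); set z := ystar M n.+1 y s in z1 z2 z3 *.
have cxy : (c sworst - c s) * x <= (c sworst - c s) * y.
  by rewrite ler_wpM2l// subr_ge0.
(* From [x], imitate the optimal level [z] of [y] if it is reachable. Otherwise transmit at full
   power: the shortfall is at most [y - x], and [g_shift_worst] bounds its effect. *)
have [zx|xz] := leP z (x + P / c s).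
  have lz : levels M x s z by apply/levelsP; split=> //; exact: le_trans z1.
  have := V_le ox lz; lra.
have lw := level_max s x0; have /levelsP[w1 w2 _] := lw.
have := V_le ox lw; have := @g_shift_worst n s _ _ IH w2 (ltW xz).
have : (c sworst - c s) * z <= (c sworst - c s) * (y + P / c s).
  by rewrite ler_wpM2l// subr_ge0.
move: (P / c s) => q; lra.
Qed.

(** In the worst channel the correction [c sworst - c s] vanishes, so [g] is nondecreasing on [[d,
    +oo[]. *)
Lemma b_worst n : b M n.+1 sworst = d.
Proof.
apply/eqP; rewrite eq_le d_le_b// andbT; apply: b_least => //.
apply/minimizers_fromP; split=> // z dz.
have := g_shift_worst sworst (@V_shift_worst n) (lexx d) dz.
by rewrite subrr !mul0r !addr0.
Qed.

(** Under a common next-state law, the increments of [g] for [s1] and [s2] differ only in their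
    linear term, and a smaller slope moves the minimizer to the right. *)
Lemma b_nonincreasing_cost n s1 s2 : iid p -> c s1 <= c s2 ->
  b M n.+1 s2 <= b M n.+1 s1.
Proof.
move=> [q pq] c12.
apply: (minimizers_from_mono (b_minimizer s2 (value_regularP n)) _
  (b_minimizer s1 (value_regularP n))) => [y|x y dx xy yb].
  exact: b_least.
rewrite /g /post_cost [n.+1.-1]/=.
under eq_bigr do rewrite pq.
under [X in _ - (_ + _ * X) <= _]eq_bigr do rewrite pq.
under [X in _ <= _ + _ * X - _]eq_bigr do rewrite pq.
under [X in _ <= _ - (_ + _ * X)]eq_bigr do rewrite pq.
have : c s1 * (y - x) <= c s2 * (y - x) by rewrite ler_wpM2r// subr_ge0.
lra.
Qed.

End Scheduling.

Theorem theorem1 (R : realType) (S : finType) (M : scheduling R S) (N : nat)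
  (sbest sworst : S)
  (N_gt0 : (0 < N)%N)
  (trans_stochastic : stochastic (trans M))
  (trans_ergodic : ergodic (trans M))
  (power_gt0 : 0 < power M)
  (drain_gt0 : 0 < drain M)
  (sbest_min : forall s, cost M sbest <= cost M s)
  (sworst_max : forall s, cost M s <= cost M sworst)
  (cmin_gt0 : 0 < cost M sbest)
  (cmax_le : cost M sworst <= power M / drain M)
  (hold_ge0 : forall x, 0 <= x -> 0 <= hold M x)
  (hold_convex :
    @convex_function R R^o `[0, +oo[%classic (hold M : R^o -> R^o))
  (hold_nondecreasing : forall x y, 0 <= x -> x <= y -> hold M x <= hold M y)
  (hold0 : hold M 0 = 0)
  (hold_infty : hold M x @[x --> +oo] --> +oo)
  (disc_itv : 0 <= disc M <= 1) :
  [/\ (forall n s, (1 <= n <= N)%N ->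
        [/\ g_minimizers M n s (b M n s),
            (forall y, g_minimizers M n s y -> b M n s <= y) &
            (forall x, 0 <= x ->
              [/\ optimal_level M n x s (ystar M n x s),
                  optimal_quantity M n x s (zstar M n x s) &
                  ystar M n x s = x + zstar M n x s])]),
      (forall s,
        [/\ b M N s <= N%:R * drain M,
            (forall n, (1 <= n < N)%N -> b M n s <= b M n.+1 s) &
            b M 1 s = drain M]) &
      (iid (trans M) ->
        forall n, (1 <= n <= N)%N ->
        forall s1 s2, cost M s1 <= cost M s2 ->
        [/\ b M n sbest <= n%:R * drain M,
            b M n s1 <= b M n sbest,
            b M n s2 <= b M n s1,
            b M n sworst <= b M n s2 &
            b M n sworst = drain M])].
Proof.
have [p_ge0 p_sum] := trans_stochastic.
have c_gt0 s : 0 < cost M s by exact: lt_le_trans (sbest_min s).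
(* Full power covers one playout in every channel, so the feasible set of levels is never empty. *)
have d_le s : drain M <= power M / cost M s.
  rewrite ler_pdivlMr// mulrC -ler_pdivlMr//.
  exact: le_trans (sworst_max s) cmax_le.
have h_convex := convex_function_from0 hold_convex.
have /andP[al_ge0 al_le1] := disc_itv.
have reg n : value_regular M n by exact: value_regularP.
have bnd n s : b M n.+1 s <= n.+1%:R * drain M by exact: b_le_nd.
split.
- case=> // n s _; split; [exact: b_minimizer|exact: b_least|move=> x x0].
  have yz : ystar M n.+1 x s = x + zstar M n.+1 x s.
    rewrite /ystar /zstar; case: ifP => _; first by rewrite addr0.
    by case: ifP => // _; rewrite addrC subrK.
  by split=> //; rewrite /optimal_quantity -?yz; exact: ystar_optimal.
- move=> s; split; [by case: N N_gt0 => // n _; exact: bnd| |exact: b1].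
  by case=> // n _; exact: b_nondecreasing.
- move=> iidM; case=> // n _ s1 s2 c12; have bw : b M n.+1 sworst = drain M.
    exact: b_worst.
  split=> //; [exact: b_nonincreasing_cost|exact: b_nonincreasing_cost|].
  by rewrite bw; exact: d_le_b.
Qed.
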